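(* For every $n$ and every $\frac1n\le\epsilon\le\frac19$, any $\epsilon$-tester (adaptive or non-adaptive) for convexity of functions $f\colon[n]\to\mathbb{R}$, where $[n]=\{0,\dots,n-1\}$, has query complexity $\Omega\!\left(\frac{\log(\epsilon n)}{\epsilon}\right)$.
   Context: A function $f\colon X\to\mathbb{R}$ on a finite set $X\subseteq\mathbb{R}^d$ is convex if for every finite collection $x_1,\dots,x_k\in X$ and reals $\lambda_i\ge0$ with $\sum_i\lambda_i=1$ and $\sum_i\lambda_ix_i\in X$, one has $f(\sum_i\lambda_ix_i)\le\sum_i\lambda_if(x_i)$. A function $g$ is $\epsilon$-far from convex if every convex $h$ differs from $g$ on at least $\epsilon|X|$ points. An $\epsilon$-tester is a randomized query algorithm that accepts every convex function with probability at least $2/3$ and rejects every function $\epsilon$-far from convex with probability at least $2/3$; its query complexity is the worst-case number of queries. *)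

(* Defs.v *)
From HB Require Import structures.
From mathcomp Require Import all_boot all_order all_algebra.
From mathcomp Require Import all_classical all_reals all_analysis.
Set Implicit Arguments. Unset Strict Implicit. Unset Printing Implicit Defensive.
Import Order.TTheory GRing.Theory Num.Theory.
Local Open Scope ring_scope.
Local Open Scope classical_set_scope.

Definition convex_on_grid (R : realType) (n : nat) (f : 'I_n -> R) : Prop :=
  forall (k : nat) (x : 'I_k -> 'I_n) (lam : 'I_k -> R),
    (forall i, 0 <= lam i) -> \sum_(i < k) lam i = 1 ->
    forall y : 'I_n, (nat_of_ord y)%:R = \sum_(i < k) lam i * (nat_of_ord (x i))%:R ->
    f y <= \sum_(i < k) lam i * f (x i).

Definition eps_far (R : realType) (n : nat) (eps : R) (g : 'I_n -> R) : Prop :=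
  forall h : 'I_n -> R, convex_on_grid h ->
    eps * n%:R <= #|[set x : 'I_n | h x != g x]|%:R.

(* A randomized adaptive query algorithm making q queries, with randomness
   omega drawn from a probability space.  On random seed omega, the i-th query
   point is  qry omega (answers so far),  and after q queries the output
   (true = accept) is  dec omega (all q answers). *)
Fixpoint answers (R : realType) (n : nat) (Omega : Type)
    (qry : Omega -> seq R -> 'I_n) (omega : Omega) (f : 'I_n -> R) (k : nat)
    : seq R :=
  match k with
  | 0 => [::]
  | k'.+1 => let a := answers qry omega f k' in rcons a (f (qry omega a))
  end.

Definition accept_event (R : realType) (n : nat) (Omega : Type)
    (qry : Omega -> seq R -> 'I_n) (dec : Omega -> seq R -> bool) (q : nat)
    (f : 'I_n -> R) : set Omega :=
  [set omega | dec omega (answers qry omega f q)].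

(* (qry, dec) with q queries over probability space P is an eps-tester for
   convexity of functions [n] -> R.  Acceptance events are required to be
   measurable so that their probabilities are meaningful. *)
Definition is_convexity_tester (R : realType) (n : nat) (eps : R)
    (d : measure_display) (Omega : measurableType d) (P : probability Omega R)
    (q : nat) (qry : Omega -> seq R -> 'I_n) (dec : Omega -> seq R -> bool) : Prop :=
  (forall f : 'I_n -> R, measurable (accept_event qry dec q f)) /\
  (forall f : 'I_n -> R, convex_on_grid f ->
      ((2 / 3 : R)%:E <= P (accept_event qry dec q f))%E) /\
  (forall f : 'I_n -> R, eps_far eps f ->
      ((2 / 3 : R)%:E <= P (~` accept_event qry dec q f))%E).

(* Main.v *)
Require Import Defs.
From HB Require Import structures.
From mathcomp Require Import all_boot all_order all_algebra.
From mathcomp Require Import all_classical all_reals all_analysis.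
From mathcomp Require Import measurable_realfun.
From mathcomp Require Import zify ring lra.
Set Implicit Arguments.
Unset Strict Implicit.
Unset Printing Implicit Defensive.
Import Order.TTheory GRing.Theory Num.Theory.
Local Open Scope ring_scope.

(* Cut [n] into m ~ 1/eps intervals of 2^L ~ eps n points, each carrying a
   binary tree of dyadic blocks.  The convex function f_A has one hidden random
   bit A(v) per block v: on v it is raised by A(v) times the weight of the level
   of v.  At the boundary of v the slope increases by enough to absorb that jump,
   so every f_A is convex.  The function g_{A,r,i} is f_A with the bits
   complemented on the right halves of the blocks of level i in the r-th
   interval.  There the two halves of a block are displaced against each other,
   so at least a quarter of the interval must be changed to restore convexity.
   A run that never queries both halves of one of these blocks cannot tell f_A
   from g_{A',r,i}, where A' is A with the bits of the blocks queried on the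
   right complemented.  Since q points separate the halves of some block for at
   most q pairs (r, i), averaging over A and over the m (L - 1) pairs gives
   q >= m (L - 1) / 3. *)

(** * Counting by relations, and geometric sums *)

(** Any choice of a related element is injective on [A]; a relation avoids writing the injection
    explicitly. *)
Lemma leq_card_rel (T U : finType) (A : {set T}) (B : {pred U})
    (rho : T -> U -> Prop) :
  (forall t, t \in A -> exists2 u, u \in B & rho t u) ->
  (forall t t' u, rho t u -> rho t' u -> t = t') ->
  (#|A| <= #|B|)%N.
Proof.
move=> total func.
have [->|[t0 t0A]] := set_0Vmem A; first by rewrite cards0.
have [u0 _ _] := total _ t0A.
have /choice [f fP] : forall t, exists u, t \in A -> u \in B /\ rho t u.
  move=> t; have [/total[u uB tu]|_] := boolP (t \in A); first by exists u.
  by exists u0.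
rewrite -(card_in_imset (f := f)); last first.
  by move=> t t' /fP[_ tf] /fP[_ tf'] eqf; apply: func tf _; rewrite eqf.
apply: subset_leq_card; apply/fintype.subsetP => _ /imsetP[t /fP[fB _] ->].
exact: fB.
Qed.

Lemma mulr_sum_geometric (R : realType) (C : R) (l : nat) :
  C * \sum_(k < l) (C + 1) ^+ k = (C + 1) ^+ l - 1.
Proof. by rewrite subrX1 addrK. Qed.

(** The terms below [i] sum to at least [1 - (C + 1) ^+ i], and the term at [i] is at least
    [(C + 1) ^+ i]. The induction strips the top level. *)
Lemma geometric_sum_gt0 (R : realType) (C : R) (l : nat) (T : 'I_l -> R)
    (i : 'I_l) : 0 <= C ->
  (forall k : 'I_l, (k < i)%N -> - C <= T k) -> 1 <= T i ->
  (forall k : 'I_l, (i < k)%N -> 0 <= T k) ->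
  0 < \sum_(k < l) (C + 1) ^+ k * T k.
Proof.
move=> C0; have K0 k : 0 <= (C + 1) ^+ k by rewrite exprn_ge0 ?addr_ge0.
elim: l T i => [T []//|l IHl] T i Tlo Ti Thi.
rewrite big_ord_recr /=.
have [eq_il|lt_il] : i = ord_max \/ (i < l)%N.
  have := ltn_ord i; rewrite ltnS leq_eqVlt => /orP[/eqP e|]; last by right.
  by left; apply: val_inj.
- rewrite eq_il in Tlo Ti.
  have lo : - C * \sum_(k < l) (C + 1) ^+ k
      <= \sum_(k < l) (C + 1) ^+ k * T (widen_ord (leqnSn l) k).
    rewrite mulr_sumr; apply: ler_sum => k _.
    by rewrite mulrC ler_wpM2l// Tlo//= ltn_ord.
  rewrite mulNr mulr_sum_geometric in lo.
  by have := ler_wpM2l (K0 l) Ti; lra.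
- have := IHl (fun k => T (widen_ord (leqnSn l) k)) (Ordinal lt_il).
  move=> IH; apply: ltr_wpDr; first by rewrite mulr_ge0// Thi.
  apply: IH => [k ki||k ki]; [exact: Tlo| |exact: Thi].
  by rewrite (_ : widen_ord _ _ = i)//; apply: val_inj.
Qed.

(** * Convexity criteria and the staircase of a single level *)

Lemma convex_of_supporting_slopes (R : realType) (n : nat) (f : 'I_n -> R) :
  (forall y, exists s, forall x : 'I_n, f y + s * (x%:R - y%:R) <= f x) ->
  convex_on_grid f.
Proof.
move=> supp k x lam lam0 lam1 y yE; have [s sP] := supp y.
have -> : f y = \sum_(i < k) lam i * (f y + s * ((x i)%:R - y%:R)).
  under eq_bigr do rewrite mulrDr mulrCA mulrBr.
  by rewrite big_split/= -mulr_sumr sumrB -!mulr_suml lam1 !mul1r -yE subrr mulr0 addr0.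
by apply: ler_sum => i _; rewrite ler_wpM2l.
Qed.

Lemma convex_three_points (R : realType) (n : nat) (f : 'I_n -> R) (x y z : 'I_n) :
  convex_on_grid f -> (x < y)%N -> (y < z)%N ->
  (z%:R - x%:R) * f y <= (z%:R - y%:R) * f x + (y%:R - x%:R) * f z.
Proof.
move=> cvx; rewrite -(ltr_nat R) -(ltr_nat R y) => xy yz.
have zx : 0 < z%:R - x%:R :> R by lra.
pose xs (i : 'I_2) := if i == ord0 then x else z.
pose lam (i : 'I_2) : R := (if i == ord0 then z%:R - y%:R else y%:R - x%:R) / (z%:R - x%:R).
have := cvx 2%N xs lam.
rewrite !big_ord_recl !big_ord0 /xs /lam /= !addr0 => /(_ _ _ y) H.
rewrite mulrC -ler_pdivlMr//.
apply: le_trans (H _ _ _) _.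
- by case=> [[|[|//]] ?] /=; apply: divr_ge0; lra.
- by field; lra.
- by field; lra.
- by rewrite le_eqVlt; apply/orP; left; apply/eqP; field; lra.
Qed.

(* Piecewise linear: slope [2 p] inside the [p]-th block of length [w], slope
   [2 p - 1] across its left boundary, so that adding a bit per block keeps the
   slopes monotone. *)
Definition stair (R : realType) (w x : nat) : R :=
  let p : R := (x %/ w)%:R in p * (2 * x%:R - (p + 1) * w%:R + 1).

Lemma divn_boundsR (R : realType) (w x : nat) : (0 < w)%N ->
  (x %/ w)%:R * w%:R <= x%:R :> R /\ x%:R + 1 <= (x %/ w)%:R * w%:R + w%:R :> R.
Proof.
move=> w0; rewrite -!natrM -!natrD natr1 !ler_nat.
by have := divn_eq x w; have := ltn_pmod x w0; lia.
Qed.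

Lemma stair_supporting_slope (R : realType) (w x y : nat) (bx bY : bool) :
  (0 < w)%N -> ((x %/ w)%N = (y %/ w)%N -> bx = bY) ->
  stair R w y + bY%:R + 2 * (y %/ w)%:R * (x%:R - y%:R) <= stair R w x + bx%:R.
Proof.
move=> w0 bE; rewrite /stair /=.
have [xl xu] := divn_boundsR R x w0.
have [yl yu] := divn_boundsR R y w0.
have wR : 0 <= w%:R :> R by [].
have b01 (b : bool) : 0 <= (b%:R : R) <= 1 by rewrite ler0n lern1 leq_b1.
have := b01 bx; have := b01 bY => bY01 bx01.
have [lt|lt|eqp] := ltngtP (y %/ w) (x %/ w); last first.
- by rewrite (bE (esym eqp)) eqp; lra.
- move: lt; rewrite -(ler_nat R) -natr1 => lt.
  move: (x %/ w)%:R (y %/ w)%:R lt xl xu yl yu => p' p lt xl xu yl yu.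
  (* Here, and symmetrically in the next case, [stair] exceeds the supporting line at [x] by these
     two products plus the distance of [p] and [p']. That distance is at least 1 and pays for the
     bits. *)
  have h1 : 0 <= 2 * (p - p') * (p' * w%:R + w%:R - 1 - x%:R) by apply: mulr_ge0; lra.
  have h2 : 0 <= w%:R * ((p - p') * (p - p' - 1)) by apply: mulr_ge0 => //; apply: mulr_ge0; lra.
  nra.
- move: lt; rewrite -(ler_nat R) -natr1 => lt.
  move: (x %/ w)%:R (y %/ w)%:R lt xl xu yl yu => p' p lt xl xu yl yu.
  have h1 : 0 <= 2 * (p' - p) * (x%:R - p' * w%:R) by apply: mulr_ge0; lra.
  have h2 : 0 <= w%:R * ((p' - p) * (p' - p - 1)) by apply: mulr_ge0 => //; apply: mulr_ge0; lra.
  nra.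
Qed.

Lemma stair_bounds (R : realType) (w x n : nat) : (0 < w)%N -> (x < n)%N ->
  0 <= stair R w x <= 2 * n%:R ^+ 2.
Proof.
move=> w0 xn; rewrite /stair.
have [xl _] := divn_boundsR R x w0.
have [->|p0] := posnP (x %/ w); first by rewrite !mul0r lexx mulr_ge0// exprn_ge0.
have px : (x %/ w)%:R <= x%:R :> R by rewrite ler_nat leq_div.
have w1 : 1 <= w%:R :> R by rewrite ler1n.
have p1 : 1 <= (x %/ w)%:R :> R by rewrite ler1n.
have {}xn : x%:R + 1 <= n%:R :> R by rewrite natr1 ler_nat.
move: (x %/ w)%:R p1 px xl => p p1 px xl.
move: w%:R x%:R n%:R w1 xn px xl => w' x' n' w1 xn px xl.
have e1 : 0 <= (p - 1) * (w' - 1) by apply: mulr_ge0; lra.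
have e2 : 0 <= p - 1 by lra.
apply/andP; split; first by apply: mulr_ge0; nra.
rewrite expr2 mulrCA; apply: ler_pM; nra.
Qed.

(** * Weighted sums over the levels *)

Lemma divn_exp2_le (x y a b : nat) : (a <= b)%N ->
  (x %/ 2 ^ a = y %/ 2 ^ a)%N -> (x %/ 2 ^ b = y %/ 2 ^ b)%N.
Proof. by move=> ab e; rewrite -(subnKC ab) expnD !divnMA e. Qed.

(** Bounds the three-point defect of one level: its values lie between 0 and [2 * n%:R ^+ 2 + 1],
    and the points are less than [n] apart. *)
Definition slack (R : realType) (n : nat) : R := n%:R * (2 * n%:R ^+ 2 + 1).

(* The weights grow so fast that, inside a block of level [k], all the levels
   below [k] together cannot compensate a unit change of the bit [b k]. *)
Definition layered (R : realType) (n l : nat) (b : 'I_l -> 'I_n -> bool)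
    (x : 'I_n) : R :=
  \sum_(k < l) (slack R n + 1) ^+ k * (stair R (2 ^ k.+1) x + (b k x)%:R).

Lemma slack_ge0 (R : realType) (n : nat) : 0 <= slack R n.
Proof. by rewrite mulr_ge0// addr_ge0// mulr_ge0// exprn_ge0. Qed.

Lemma layered_convex (R : realType) (n l : nat) (b : 'I_l -> 'I_n -> bool) :
  (forall (k : 'I_l) (x y : 'I_n),
     (x %/ 2 ^ k.+1 = y %/ 2 ^ k.+1)%N -> b k x = b k y) ->
  convex_on_grid (layered R b).
Proof.
move=> bE; apply: convex_of_supporting_slopes => y.
exists (\sum_(k < l) (slack R n + 1) ^+ k * (2 * (y %/ 2 ^ k.+1)%:R)) => x.
rewrite mulr_suml -big_split; apply: ler_sum => k _ /=.
rewrite -mulrA -mulrDr ler_wpM2l//.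
  by rewrite exprn_ge0// addr_ge0// slack_ge0.
by apply: stair_supporting_slope; [rewrite expn_gt0|exact: bE].
Qed.

(** Inside a block of level [i] the staircases of levels [i] and above are affine. So levels above
    [i] contribute 0, level [i] contributes [y - x] or [z - y] through its bits, and each lower
    level contributes at least [- slack R n]. *)
Lemma layered_not_convex (R : realType) (n l : nat) (b : 'I_l -> 'I_n -> bool)
    (i : 'I_l) (x y z : 'I_n) :
  (x < y)%N -> (y < z)%N ->
  (x %/ 2 ^ i.+1 = y %/ 2 ^ i.+1)%N -> (z %/ 2 ^ i.+1 = y %/ 2 ^ i.+1)%N ->
  (forall k : 'I_l, (i < k)%N -> b k x = b k y /\ b k z = b k y) ->
  b i y -> b i x (+) b i z ->
  (z%:R - y%:R) * layered R b x + (y%:R - x%:R) * layered R b z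
    < (z%:R - x%:R) * layered R b y.
Proof.
move=> xy yz xE zE bE biy bixz.
have nz : z%:R <= n%:R :> R by rewrite ler_nat ltnW.
have x0 : 0 <= x%:R :> R by [].
have xyR : x%:R + 1 <= y%:R :> R by rewrite natr1 ler_nat.
have yzR : y%:R + 1 <= z%:R :> R by rewrite natr1 ler_nat.
rewrite -subr_gt0 /layered !mulr_sumr -big_split -sumrB /=.
pose F (k : 'I_l) (u : 'I_n) : R := stair R (2 ^ k.+1) u + (b k u)%:R.
rewrite (eq_bigr (fun k : 'I_l => (slack R n + 1) ^+ k *
   ((z%:R - x%:R) * F k y - ((z%:R - y%:R) * F k x + (y%:R - x%:R) * F k z))));
  last by move=> k _; rewrite /F; ring.
apply: (geometric_sum_gt0 (i := i)); first exact: slack_ge0.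
- move=> k _.
  have Fb u : 0 <= F k u <= 2 * n%:R ^+ 2 + 1.
    have := @stair_bounds R (2 ^ k.+1) u n; rewrite expn_gt0 ltn_ord => /(_ isT isT).
    have : 0 <= ((b k u)%:R : R) <= 1 by rewrite ler0n lern1 leq_b1.
    by rewrite /F; lra.
  rewrite /slack; set M := 2 * _ + 1 in Fb *.
  have := Fb x; have := Fb y; have := Fb z.
  move: (F k x) (F k y) (F k z) => fx fy fz /andP[fz0 fzM] /andP[fy0 fyM] /andP[fx0 fxM].
  have h1 : 0 <= (z%:R - x%:R) * fy by apply: mulr_ge0; lra.
  have h2 : (z%:R - y%:R) * fx <= (z%:R - y%:R) * M by apply: ler_wpM2l => //; lra.
  have h3 : (y%:R - x%:R) * fz <= (y%:R - x%:R) * M by apply: ler_wpM2l => //; lra.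
  have h4 : (z%:R - x%:R) * M <= n%:R * M by apply: ler_wpM2r; lra.
  by lra.
- rewrite /F /stair /= xE zE biy.
  by case: (b i x) (b i z) bixz => [] [] // _ /=; rewrite -subr_ge0; nra.
- move=> k ik; have [bx bz] := bE _ ik.
  rewrite /F /stair /= (divn_exp2_le _ xE) ?(divn_exp2_le _ zE)// ?ltnS 1?ltnW//.
  by rewrite bx bz le_eqVlt; apply/orP; left; apply/eqP; ring.
Qed.

(** * Blocks, hidden bits and split blocks *)

Definition block (n k : nat) (x : 'I_n) : 'I_n :=
  Ordinal (leq_ltn_trans (leq_div x (2 ^ k.+1)) (ltn_ord x)).

Lemma block_eq (n k : nat) (x y : 'I_n) :
  (block k x == block k y) = (x %/ 2 ^ k.+1 == y %/ 2 ^ k.+1)%N.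
Proof. by []. Qed.

Definition coherent_bits (n l : nat) (A : {ffun 'I_l * 'I_n -> bool})
  (k : 'I_l) (x : 'I_n) : bool := A (k, block k x).

(* [r] is the index of an interval of length [2 ^ l]; a block of level [i] has
   length [2 ^ i.+1]. *)
Definition in_right_half (n l r i : nat) (x : 'I_n) : bool :=
  ((x %/ 2 ^ l == r) && odd (x %/ 2 ^ i))%N.

Definition twisted_bits (n l : nat) (A : {ffun 'I_l * 'I_n -> bool})
    (r : nat) (i : 'I_l) (k : 'I_l) (x : 'I_n) : bool :=
  A (k, block k x) (+) ((k == i) && in_right_half l r i x).

(** The event that queries at [S] can expose the twist at [(r, i)]. *)
Definition splits (n l : nat) (S : {set 'I_n}) (r i : nat) : bool :=
  [exists x in S, exists y in S, [&& (x %/ 2 ^ l == r)%N,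
     (x %/ 2 ^ i.+1 == y %/ 2 ^ i.+1)%N, odd (x %/ 2 ^ i) & ~~ odd (y %/ 2 ^ i)]].

Lemma divn_exp2S (x i : nat) : (x %/ 2 ^ i.+1 = (x %/ 2 ^ i)./2)%N.
Proof. by rewrite expnSr divnMA divn2. Qed.

(* The point charged for a split at [(r, i)] is the least point [x] of [S] in
   the right half; its predecessor in [S] then lies in the left half, so that
   [x] determines [(r, i)]. *)
Lemma card_splits (n l m : nat) (S : {set 'I_n}) :
  (#|[set t : 'I_m * 'I_l | splits l.+1 S t.1 t.2.+1]| <= #|S|)%N.
Proof.
pose rho (t : 'I_m * 'I_l) (x : 'I_n) : Prop :=
  (x %/ 2 ^ l.+1)%N = t.1 /\ exists2 y : 'I_n, y \in S &
   [/\ (y < x)%N, (forall z : 'I_n, z \in S -> (y < z < x)%N = false),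
       (x %/ 2 ^ t.2.+2)%N = (y %/ 2 ^ t.2.+2)%N
     & (x %/ 2 ^ t.2.+1)%N <> (y %/ 2 ^ t.2.+1)%N].
apply: (leq_card_rel (rho := rho)) => [[r j]|[r j] [r' j'] x].
- rewrite inE => /exists_inP[x xS /exists_inP[y yS /and4P[/= /eqP xr /eqP xy xo ye]]].
  set p := (x %/ 2 ^ j.+2)%N in xy.
  pose QR (u : 'I_n) := [&& u \in S, (u %/ 2 ^ j.+2 == p)%N & odd (u %/ 2 ^ j.+1)].
  pose QL (u : 'I_n) := [&& u \in S, (u %/ 2 ^ j.+2 == p)%N & ~~ odd (u %/ 2 ^ j.+1)].
  have QRx : QR x by rewrite /QR xS eqxx.
  have QLy : QL y by rewrite /QL yS -xy eqxx.
  case: (arg_minnP (fun u : 'I_n => u : nat) QRx) => u /and3P[uS /eqP up uo] umin.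
  case: (arg_maxnP (fun u : 'I_n => u : nat) QLy) => v /and3P[vS /eqP vp ve] vmax.
  have ne : (u %/ 2 ^ j.+1)%N <> (v %/ 2 ^ j.+1)%N by move=> e; rewrite -e uo in ve.
  exists u => //; split.
    by rewrite -xr; apply: (@divn_exp2_le _ _ j.+2) => //; rewrite ltnS.
  exists v => //; split => //; last by rewrite up vp.
    rewrite ltnNge; apply/negP => /(leq_div2r (2 ^ j.+1)).
    have := odd_double_half (u %/ 2 ^ j.+1); have := odd_double_half (v %/ 2 ^ j.+1).
    by rewrite -!divn_exp2S up vp uo (negbTE ve) => <- <-; rewrite ltnn.
  move=> z zS; apply/negP => /andP[vz zu].
  have zp : (z %/ 2 ^ j.+2 == p)%N.
    by rewrite eqn_leq -{1}up -vp !leq_div2r// ltnW.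
  have [zo|ze] := boolP (odd (z %/ 2 ^ j.+1)).
    by have := umin z; rewrite /QR zS zp zo leqNgt zu => /(_ isT).
  by have := vmax z; rewrite /QL zS zp ze => /(_ isT); rewrite /= leqNgt vz.
- move=> [/= xr [y yS [yx yP eq ne]]] [/= xr' [y' yS' [yx' yP' eq' ne']]].
  have yy' : y = y'.
    apply: val_inj => /=; have := yP _ yS'; have := yP' _ yS.
    by rewrite yx yx' !andbT; case: ltngtP.
  (* The interval of [x] gives [r]; the level is the only one at which [x] and [y] share a block but
     not a half. *)
  rewrite -yy' in eq' ne'; congr pair; apply: val_inj; rewrite /= -?xr//.
  have [lt|lt|//] := ltngtP j j'.
    by case: ne'; apply: divn_exp2_le eq.
  by case: ne; apply: divn_exp2_le eq'.
Qed.

(** * Runs that cannot tell convex from twisted functions *)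

Lemma eq_answers (R : realType) (n : nat) (Omega : Type)
    (qry : Omega -> seq R -> 'I_n) (w : Omega) (f g : 'I_n -> R) (q : nat) :
  (forall j, (j < q)%N ->
     g (qry w (answers qry w f j)) = f (qry w (answers qry w f j))) ->
  forall j, (j <= q)%N -> answers qry w g j = answers qry w f j.
Proof.
by move=> fg; elim=> [//|j IHj] jq /=; rewrite IHj ?fg// ltnW.
Qed.

Definition queried (R : realType) (n : nat) (Omega : Type)
    (qry : Omega -> seq R -> 'I_n) (w : Omega) (q : nat) (f : 'I_n -> R) :
    {set 'I_n} :=
  [set qry w (answers qry w f j) | j : 'I_q].

Lemma card_queried (R : realType) (n : nat) (Omega : Type)
    (qry : Omega -> seq R -> 'I_n) (w : Omega) (q : nat) (f : 'I_n -> R) :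
  (#|queried qry w q f| <= q)%N.
Proof. by rewrite -[leqRHS]card_ord; apply: leq_imset_card. Qed.

Definition flip (n l : nat) (S : {set 'I_n}) (r : nat) (i : 'I_l)
    (A : {ffun 'I_l * 'I_n -> bool}) : {ffun 'I_l * 'I_n -> bool} :=
  [ffun kp => A kp (+) ((kp.1 == i) &&
     [exists y in S, (block i y == kp.2) && in_right_half l r i y])].

Lemma flipK (n l : nat) (S : {set 'I_n}) (r : nat) (i : 'I_l) :
  involutive (flip S r i).
Proof. by move=> A; apply/ffunP => kp; rewrite !ffunE addbK. Qed.

(** Without a split, a block met by [S] on the right is met only there, so flip and twist cancel at
    [x]; on other blocks neither acts at [x]. *)
Lemma twisted_flip (n l : nat) (S : {set 'I_n}) (r : nat) (i k : 'I_l)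
    (A : {ffun 'I_l * 'I_n -> bool}) (x : 'I_n) :
  ~~ splits l S r i -> x \in S ->
  twisted_bits (flip S r i A) r i k x = coherent_bits A k x.
Proof.
move=> nsplit xS; rewrite /twisted_bits /coherent_bits ffunE /=.
have [->|] := eqVneq k i; last by rewrite !addbF.
rewrite /=; suff -> : [exists y in S, (block i y == block i x) && in_right_half l r i y]
    = in_right_half l r i x by rewrite addbK.
apply/exists_inP/idP => [[y yS /andP[yx /andP[/eqP yr yo]]]|xr]; last first.
  by exists x; rewrite ?eqxx.
rewrite block_eq in yx; move/eqP in yx; apply/andP; split.
  by rewrite -yr; apply/eqP; apply: (@divn_exp2_le _ _ i.+1).
apply/negPn/negP => xe; case/negP: nsplit.
apply/exists_inP; exists y => //; apply/exists_inP; exists x => //.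
by rewrite yr yx yo xe !eqxx.
Qed.

(** Outside the split event, [phi] preserves the transcript, hence the decision. It is injective
    there: the run on [g (phi A)] reveals the queried set, and flipping along that set again
    recovers [A]. *)
Lemma count_accepting (R : realType) (n l q r : nat) (Omega : Type)
    (qry : Omega -> seq R -> 'I_n) (dec : seq R -> bool) (w : Omega) (i : 'I_l) :
  (#|[set A : {ffun 'I_l * 'I_n -> bool} |
        dec (answers qry w (layered R (coherent_bits A)) q)]| <=
   #|[set A : {ffun 'I_l * 'I_n -> bool} |
        dec (answers qry w (layered R (twisted_bits A r i)) q)]| +
   #|[set A : {ffun 'I_l * 'I_n -> bool} |
        splits l (queried qry w q (layered R (coherent_bits A))) r i]|)%N.
Proof.
set D := [set A | _]; set E := [set A | _]; set X := [set A | _].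
pose f (A : {ffun 'I_l * 'I_n -> bool}) := layered R (coherent_bits A).
pose g (A : {ffun 'I_l * 'I_n -> bool}) := layered R (twisted_bits A r i).
pose phi A := flip (queried qry w q (f A)) r i A.
have same A : A \notin X ->
    forall j, (j <= q)%N -> answers qry w (g (phi A)) j = answers qry w (f A) j.
  rewrite inE => nX; apply: eq_answers => j jq.
  apply: eq_bigr => k _; rewrite twisted_flip//.
  by apply/imsetP; exists (Ordinal jq).
have sameq A : A \notin X -> queried qry w q (g (phi A)) = queried qry w q (f A).
  by move=> nX; apply: eq_imset => j; rewrite same// ltnW.
have leDX : (#|D :\: X| <= #|E|)%N.
  rewrite -(card_in_imset (f := phi)); last first.
    move=> A B; rewrite !inE -/(f A) -/(f B) => /andP[AX _] /andP[BX _] eqp.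
    rewrite -[LHS](flipK (queried qry w q (f A)) r i) -/(phi A).
    rewrite -[RHS](flipK (queried qry w q (f B)) r i) -/(phi B).
    by rewrite -(sameq A) ?inE// -(sameq B) ?inE// eqp.
  apply: subset_leq_card; apply/fintype.subsetP => _ /imsetP[A AD ->].
  by move: AD; rewrite inE => /andP[AX]; rewrite !inE -/(f A) -/(g (phi A)) same.
by rewrite -(cardsID X D) addnC leq_add// subset_leq_card// subsetIr.
Qed.

(** * Distance of the twisted functions from convexity *)

(** Coordinates of a point: block [B], half [e1], pair [b] within the half, member [e0] of the
    pair. *)
Lemma quad_div (B w b e0 e1 : nat) : (b < w)%N -> (e0 < 2)%N -> (e1 < 2)%N ->
  let x := (B * (4 * w) + e1 * (2 * w) + 2 * b + e0)%N in
  [/\ (x %/ (4 * w) = B)%N, (x %/ (2 * w) = 2 * B + e1)%N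
    & ((x %% (2 * w)) %/ 2 = b)%N].
Proof.
move=> bw e02 e12 x.
have xE : x = ((2 * B + e1) * (2 * w) + (2 * b + e0))%N by rewrite /x; lia.
have small : (2 * b + e0 < 2 * w)%N by lia.
split.
- rewrite /x -!addnA divnMDl ?divn_small ?addn0//; first nia.
  by case: e1 e12 {x xE} => [|[|]]//; lia.
- by rewrite xE divnMDl ?divn_small ?addn0//; lia.
- by rewrite xE modnMDl modn_small// mulnC divnMDl// divn_small ?addn0.
Qed.

Lemma quad_lt (r s w a b e0 e1 : nat) :
  (a < s)%N -> (b < w)%N -> (e0 < 2)%N -> (e1 < 2)%N ->
  ((r * s + a) * (4 * w) + e1 * (2 * w) + 2 * b + e0 < r.+1 * (4 * w * s))%N.
Proof.
move=> lt_as bw e02 e12.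
have h1 : (e1 * (2 * w) <= 2 * w)%N.
  by rewrite -{2}[(2 * w)%N]mul1n leq_mul2r -ltnS e12 orbT.
have h2 : (a.+1 * (4 * w) <= s * (4 * w))%N by rewrite leq_mul2r lt_as orbT.
rewrite (mulSn r) mulnDl; move: h2; rewrite (mulSn a).
have -> : (r * (4 * w * s) = r * s * (4 * w))%N by rewrite (mulnC _ s) mulnA.
rewrite (mulnC (4 * w)%N s); lia.
Qed.

(** Level 0 is skipped by [lift ord0]: its blocks have two points, too few for a violating
    triple. *)
Lemma twisted_far (R : realType) (n l r : nat) (j : 'I_l)
    (A : {ffun 'I_l.+1 * 'I_n -> bool}) (eps : R) :
  (r.+1 * 2 ^ l.+1 <= n)%N -> eps * n%:R <= (2 ^ l.-1)%:R ->
  eps_far eps (layered R (twisted_bits A r (lift ord0 j))).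
Proof.
move=> rn epsn h hcvx; apply: le_trans epsn _; rewrite ler_nat.
set i := lift ord0 j; set g := layered R _.
pose D : {pred 'I_n} := [pred x | h x != g x].
rewrite (_ : #|_| = #|D|); last first.
  by apply: eq_card => x; apply/idP/idP; rewrite !inE.
(* The interval is a disjoint union of quadruples x, x+1, x+2^i, x+1+2^i with x
   in a left half; each contains a triple violating convexity. *)
pose w := (2 ^ j)%N; pose s := (2 ^ (l - j.+1))%N.
have jl : (j.+1 <= l)%N by [].
have w0 : (0 < w)%N by rewrite expn_gt0.
have i1 : (2 ^ i)%N = (2 * w)%N by rewrite lift0 expnS.
have i2 : (2 ^ i.+1)%N = (4 * w)%N by rewrite lift0 !expnS; lia.
have sw : (4 * w * s = 2 ^ l.+1)%N by rewrite -i2 lift0 -expnD; congr (_ ^ _)%N; lia.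
have -> : (2 ^ l.-1)%N = #|[set: 'I_s * 'I_w]|.
  by rewrite cardsT card_prod !card_ord -expnD; congr (_ ^ _)%N; lia.
clearbody w s.
apply: (leq_card_rel (rho := fun (t : 'I_s * 'I_w) (x : 'I_n) =>
  (x %/ (4 * w) = r * s + t.1)%N /\ ((x %% (2 * w)) %/ 2 = t.2)%N)); last first.
  move=> [a b] [a' b'] x /= [xa xb] [xa' xb'].
  congr pair; apply: val_inj => /=; last by rewrite -xb.
  by apply: (@addnI (r * s)%N); rewrite -xa.
move=> [a b] _; pose B := (r * s + a)%N.
have ltn_pt (e0 e1 : bool) : (B * (4 * w) + e1 * (2 * w) + 2 * b + e0 < n)%N.
  by apply: leq_trans rn; rewrite -sw quad_lt// ltnS leq_b1.
pose pt e0 e1 : 'I_n := Ordinal (ltn_pt e0 e1).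
have ptP (e0 e1 : bool) : [/\ (pt e0 e1 %/ (4 * w) = B)%N,
    (pt e0 e1 %/ (2 * w) = 2 * B + e1)%N & ((pt e0 e1 %% (2 * w)) %/ 2 = b)%N].
  by apply: quad_div => //; rewrite ltnS leq_b1.
suff [e0 [e1 De]] : exists e0 e1, pt e0 e1 \in D.
  by exists (pt e0 e1) => //; have [-> _ ->] := ptP e0 e1.
have ptdiv (e0 e1 : bool) k : (i <= k)%N -> (pt e0 e1 %/ 2 ^ k.+1 = B * (4 * w) %/ 2 ^ k.+1)%N.
  move=> ik; apply: (@divn_exp2_le _ _ i.+1) => //.
  by rewrite i2; have [-> _ _] := ptP e0 e1; rewrite mulnK// muln_gt0.
apply: contrapT => noD.
have agree e0 e1 : h (pt e0 e1) = g (pt e0 e1).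
  apply/eqP/negPn/negP => ne; apply: noD; exists e0, e1.
  exact: ne.
have bits e0 e1 : twisted_bits A r i i (pt e0 e1) = A (i, block i (pt false false)) (+) e1.
  rewrite /twisted_bits eqxx /in_right_half /=; congr (A (_, _) (+) _).
    by apply/eqP; rewrite block_eq !ptdiv.
  have [pB p2 _] := ptP e0 e1.
  rewrite i1 p2 -sw divnMA pB /B divnMDl ?(leq_ltn_trans _ (ltn_ord a))// divn_small// addn0 eqxx.
  by rewrite oddD mul2n odd_double; case: (e1).
have bitsk (k : 'I_l.+1) e0 e1 e0' e1' : (i < k)%N ->
    twisted_bits A r i k (pt e0 e1) = twisted_bits A r i k (pt e0' e1').
  move=> ik; rewrite /twisted_bits (_ : k == i = false) ?addbF; last first.
    by apply/negbTE; rewrite neq_ltn ik orbT.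
  by congr (A (_, _)); apply/eqP; rewrite block_eq !ptdiv// ltnW.
pose v := A (i, block i (pt false false)).
(* The bit is [v] on the left half and its complement on the right. The middle point must have bit
   1, and exactly one outer point too. *)
pose y := if v then pt true false else pt false true.
pose z := if v then pt false true else pt true true.
have := @layered_not_convex R n l.+1 (twisted_bits A r i) i (pt false false) y z.
have xy : (pt false false < y)%N by rewrite /y; case: (v) => /=; clear -w0; lia.
have yz : (y < z)%N by rewrite /y /z; case: (v) => /=; clear -w0; lia.
move=> /(_ xy yz) bad; have := convex_three_points hcvx xy yz.
have -> : h y = g y by rewrite /y; case: (v).
have -> : h z = g z by rewrite /z; case: (v).
rewrite agree leNgt bad//.
- by rewrite /y; case: (v); rewrite !ptdiv.
- by rewrite /y /z; case: (v); rewrite !ptdiv.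
- by move=> k ik; rewrite /y /z; case: (v); split; apply: bitsk.
- by rewrite /y; case: ifP => vE; rewrite bits -/v vE.
- by rewrite bits /z; case: ifP => vE; rewrite bits -/v vE.
Qed.

(** * Averaging over the seed and the hidden bits *)

Lemma expected_count_le (R : realType) (d : measure_display)
    (Omega : measurableType d) (P : probability Omega R) (I : finType)
    (E G : I -> set Omega) (C : nat) (a b : R) :
  (forall i, measurable (E i)) -> (forall i, measurable (G i)) ->
  (forall w, (\sum_i (w \in E i) <= \sum_i (w \in G i) + C)%N) ->
  (forall i, a%:E <= P (E i))%E -> (forall i, P (G i) <= b%:E)%E ->
  #|I|%:R * a <= #|I|%:R * b + C%:R.
Proof.
move=> mE mG EG aE Gb.
have mI (F : I -> set Omega) : (forall i, measurable (F i)) ->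
    forall i, measurable_fun setT (fun w => (\1_(F i) w : R)%:E).
  by move=> mF i; apply/measurable_EFinP; exact: measurable_indic.
have int (F : I -> set Omega) : (forall i, measurable (F i)) ->
    (\int[P]_w \sum_i (\1_(F i) w)%:E = \sum_i P (F i))%E.
  move=> mF; rewrite ge0_integral_sum//; last exact: mI.
  by apply: eq_bigr => i _; rewrite integral_indic// setIT.
have ms (F : I -> set Omega) : (forall i, measurable (F i)) ->
    measurable_fun setT (fun w => \sum_i (\1_(F i) w : R)%:E)%E.
  by move=> mF; apply: emeasurable_sum => i; exact: mI.
have s0 (F : I -> set Omega) w : (0 <= \sum_i (\1_(F i) w)%:E :> \bar R)%E.
  by apply: sume_ge0 => i _; rewrite lee_fin.
have : (\int[P]_w \sum_i (\1_(E i) w)%:E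
    <= \int[P]_w (\sum_i (\1_(G i) w)%:E + C%:R%:E))%E.
  apply: ge0_le_integral => //; first exact: ms.
    by apply: emeasurable_funD => //; exact: ms.
  move=> w _; rewrite !sumEFin -EFinD lee_fin.
  by have := EG w; rewrite -(ler_nat R) natrD !natr_sum.
rewrite ge0_integralD//; last exact: ms.
rewrite !int// integral_cst//.
rewrite (_ : _ [set: Omega]%classic = 1%E) ?mule1 => [le_sum|]; last exact: probability_setT.
rewrite -lee_fin EFinD; apply: le_trans (le_trans le_sum _).
  rewrite mulr_natl -sumr_const -sumEFin.
  by apply: lee_sum => i _; exact: aE.
rewrite leeD2r// mulr_natl -sumr_const -sumEFin.
by apply: lee_sum => i _; exact: Gb.
Qed.

Lemma tester_queries_ge (R : realType) (n l m q : nat) (eps : R)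
    (d : measure_display) (Omega : measurableType d) (P : probability Omega R)
    (qry : Omega -> seq R -> 'I_n) (dec : Omega -> seq R -> bool) :
  (m * 2 ^ l.+1 <= n)%N -> eps * n%:R <= (2 ^ l.-1)%:R ->
  is_convexity_tester eps P q qry dec ->
  (m * l)%:R <= 3 * q%:R :> R.
Proof.
move=> mn epsn [macc [accept reject]].
pose bits := {ffun 'I_l.+1 * 'I_n -> bool}.
pose f (A : bits) : 'I_n -> R := layered R (coherent_bits A).
pose g (A : bits) (t : 'I_m * 'I_l) : 'I_n -> R :=
  layered R (twisted_bits A t.1 (lift ord0 t.2)).
have fcvx A : convex_on_grid (f A).
  apply: layered_convex => k x y xy.
  by congr (A (_, _)); apply/eqP; rewrite block_eq xy.
have gfar A t : eps_far eps (g A t).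
  apply: twisted_far epsn; apply: leq_trans mn.
  by rewrite leq_mul2r ltn_ord orbT.
have count w : (\sum_(p : bits * ('I_m * 'I_l)) (w \in accept_event qry dec q (f p.1)) <=
    \sum_(p : bits * ('I_m * 'I_l)) (w \in accept_event qry dec q (g p.1 p.2)) +
    q * #|{: bits}|)%N.
  have inacc h : (w \in accept_event qry dec q h) = dec w (answers qry w h q).
    by apply/idP/idP; rewrite inE.
  have card (T : finType) (Q : pred T) : (\sum_A Q A = #|[set A | Q A]|)%N.
    by rewrite -sum1dep_card [RHS]big_mkcond; apply: eq_bigr => A _; case: (Q A).
  have cardacc (h : bits -> 'I_n -> R) :
      (\sum_A (w \in accept_event qry dec q (h A))
       = #|[set A | dec w (answers qry w (h A) q)]|)%N.
    by rewrite card; apply: eq_card => A; rewrite !inE inacc.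
  rewrite -(pair_big xpredT xpredT (fun A t => w \in accept_event qry dec q (f A) : nat)) /=.
  rewrite -(pair_big xpredT xpredT (fun A t => w \in accept_event qry dec q (g A t) : nat)) /=.
  (* For fixed [t], the sums over [A] are compared by [count_accepting]; the split terms are then
     summed over [t] for fixed [A], giving at most [q]. *)
  rewrite exchange_big [X in (_ <= X + _)%N]exchange_big /=.
  pose sp A (t : 'I_m * 'I_l) := splits l.+1 (queried qry w q (f A)) t.1 (lift ord0 t.2).
  have le_t (t : 'I_m * 'I_l) : (\sum_A (w \in accept_event qry dec q (f A)) <=
     \sum_A (w \in accept_event qry dec q (g A t)) + \sum_A sp A t)%N.
    rewrite (cardacc f) (cardacc (g^~ t)) (card _ (sp^~ t)).
    exact: (count_accepting q t.1 qry (dec w) w (lift ord0 t.2)).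
  apply: (@leq_trans (\sum_t
      (\sum_A (w \in accept_event qry dec q (g A t)) + \sum_A sp A t))%N).
    by apply: leq_sum => t _; exact: le_t.
  rewrite big_split leq_add2l /= exchange_big /= mulnC -sum_nat_const.
  apply: leq_sum => A _; rewrite (card _ (sp A)).
  apply: leq_trans (card_queried qry w q (f A)).
  apply: leq_trans (card_splits l m (queried qry w q (f A))).
  by apply: subset_leq_card; apply/fintype.subsetP => t; rewrite !inE /sp lift0.
have grej (p : bits * ('I_m * 'I_l)) :
    (P (accept_event qry dec q (g p.1 p.2)) <= (1 / 3 : R)%:E)%E.
  case: p => A t /=; have := reject _ (gfar A t).
  rewrite probability_setC//.
  by rewrite -(fineK (fin_num_measure P _ (macc (g A t)))) -EFinB !lee_fin; lra.
have := expected_count_le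
  (fun p : bits * ('I_m * 'I_l) => macc (f p.1)) (fun p => macc (g p.1 p.2))
  count (fun p => accept _ (fcvx p.1)) grej.
rewrite card_prod card_prod !card_ord.
have N0 : 0 < #|{: bits}|%:R :> R.
  by rewrite ltr0n; apply/card_gt0P; exists [ffun=> false].
rewrite !natrM => le; rewrite -(ler_pM2l N0); lra.
Qed.

(** * Choice of parameters and the final bound *)

Theorem theorem1p3 :
  exists c : rat, 0 < c /\
  forall (R : realType) (n : nat) (eps : R), (0 < n)%N ->
    n%:R^-1 <= eps -> eps <= 9^-1 ->
    forall (d : measure_display) (Omega : measurableType d)
           (P : probability Omega R) (q : nat)
           (qry : Omega -> seq R -> 'I_n) (dec : Omega -> seq R -> bool),
      is_convexity_tester eps P q qry dec ->
      ratr c * (ln (eps * n%:R) / eps) <= q%:R.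
Proof.
(* 48 is 3 from [tester_queries_ge] times 16 from [m16]. *)
exists 48^-1; split=> // R n eps n0 epsl epsu d Omega P q qry dec tester.
rewrite fmorphV rmorph_nat.
have nR : 1 <= n%:R :> R by rewrite ler1n.
have eps0 : 0 < eps by apply: lt_le_trans epsl; rewrite invr_gt0; lra.
have en1 : 1 <= eps * n%:R by rewrite -ler_pdivrMr ?div1r//; lra.
have en9 : 9 * (eps * n%:R) <= n%:R.
  by have := ler_wpM2r (ler0n R n) epsu; lra.
(* The least such [L] makes a quarter of an interval at least [eps * n], while [2 ^ L] stays below
   [8 * (eps * n)], hence below [n] as [eps <= 1/9]. *)
have exL : exists L, 4 * (eps * n%:R) <= (2 ^ L)%:R.
  exists n; apply: (@le_trans _ _ n%:R); first lra.
  by rewrite ler_nat ltnW// ltn_expl.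
case: (ex_minnP exL) => L Lge Lmin.
have {exL} L2 : (2 <= L)%N.
  by case: L Lge {Lmin} => [|[|//]]; rewrite ?expn0 ?expn1; lra.
case: L L2 Lge Lmin => [//|[//|l]] _ Lge Lmin.
have Llt : (2 ^ l.+2)%:R < 8 * (eps * n%:R).
  rewrite expnS natrM ltNge; apply/negP => le8.
  by have := Lmin l.+1; rewrite ltnn => /(_ _)/notF; apply; lra.
have W0 : 0 < (2 ^ l.+2)%:R :> R by rewrite ltr0n expn_gt0.
pose m := (n %/ 2 ^ l.+2)%N.
have epsn : eps * n%:R <= (2 ^ l.+1.-1)%:R.
  by move: Lge; rewrite /= !expnS !natrM; lra.
have := tester_queries_ge (m := m) (leq_trunc_div n _) epsn tester.
have m0 : (1 <= m)%N.
  by rewrite divn_gt0 ?expn_gt0// -(ler_nat R); lra.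
have m16 : 1 <= 16 * (eps * m%:R).
  have W0n : (0 < 2 ^ l.+2)%N by rewrite expn_gt0.
  have [_] := divn_boundsR R n W0n; rewrite -/m => nm.
  have m1 : 1 <= m%:R :> R by rewrite ler1n.
  (* Rounding in [m] costs a factor 2, since [n] is less than [m + 1 <= 2 * m] interval lengths. *)
  have n2 : n%:R <= 2 * m%:R * (2 ^ l.+2)%:R :> R by nra.
  have n3 : n%:R <= 2 * m%:R * (8 * (eps * n%:R)).
    by apply: le_trans n2 _; apply: ler_wpM2l; lra.
  by rewrite -(ler_pM2r (x := n%:R)); lra.
have lnl : ln (eps * n%:R) <= l.+1%:R.
  apply: (@le_trans _ _ (ln ((2 ^ l.+1)%:R))).
    by rewrite ler_ln ?posrE ?ltr0n ?expn_gt0//; [move: Lge; rewrite expnS natrM|]; lra.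
  rewrite natrX lnXn// -[leRHS]mulr1 mulr_natl ler_wMn2r//.
  by have := @le_ln1Dx R 1; rewrite (_ : 1 + 1 = 2)//; apply; lra.
rewrite natrM => qge.
rewrite mulrA ler_pdivrMr//.
have h1 : l.+1%:R <= 16 * (eps * m%:R) * l.+1%:R by rewrite ler_peMl.
have h2 : eps * (m%:R * l.+1%:R) <= eps * (3 * q%:R) by rewrite ler_wpM2l// ltW.
lra.
Qed.
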